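(* For every complex number $q$ with $|q|<1$, $$\Psi(q^{15},q^3)=\sum_{n=0}^\infty \frac{(-1)^nq^{n(n+3)/2}(q^3;q^3)_n(1-q^{n+1})}{(q;q)_{2n+2}}.$$
   Context: Notation: $(a;q)_n=\prod_{j=0}^{n-1}(1-aq^j)$ (so $(a;q)_0=1$); the base may be replaced by a power of $q$. The false theta series is $$\Psi(a,b)=\sum_{n=0}^\infty a^{n(n+1)/2}b^{n(n-1)/2}-\sum_{n=1}^\infty a^{n(n-1)/2}b^{n(n+1)/2}$$ for $|ab|<1$ (with $0^0=1$). *)

(* Defs.v *)
From Stdlib Require Import Reals.
From Coquelicot Require Import Coquelicot.

Local Open Scope C_scope.

(* [qPoch a q n] is the q-shifted factorial (a;q)_n. *)
Fixpoint qPoch (a q : C) (n : nat) : C :=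
  match n with
  | O => 1
  | S m => qPoch a q m * (1 - a * q ^ m)
  end.

(* The sum of a complex series. Coquelicot's [Series] is real-valued; as for
   [RInt], [iota] picks the unique sum when the series converges, and its value
   is irrelevant otherwise. *)
Definition CSeries (u : nat -> C) : C :=
  @iota (CompleteNormedModule.CompleteSpace C_AbsRing C_CompleteNormedModule)
    (is_series u).

Lemma CSeries_unique (u : nat -> C) (l : C) : is_series u l -> CSeries u = l.
Proof.
exact (@iota_filterlim_locally C_AbsRing C_CompleteNormedModule nat eventually
         _ (sum_n u) l).
Qed.

(* The false theta series, meaningful for |ab| < 1, where both series converge.
   The second one, which starts at n = 1, is reindexed by n := k + 1. At n = 0
   the truncated [n - 1] is harmless, since it is multiplied by n; also
   [0 ^ 0 = 1] holds by definition. *)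
Definition Psi (a b : C) : C :=
  CSeries (fun n => a ^ (n * (n + 1) / 2) * b ^ (n * (n - 1) / 2)) -
  CSeries (fun k => a ^ ((k + 1) * k / 2) * b ^ ((k + 1) * (k + 2) / 2)).

(* Main.v *)
Require Import Defs.
From Stdlib Require Import Reals Lra Lia.
From Coquelicot Require Import Coquelicot.

Local Open Scope C_scope.

(** Write V_k for the Lucas sequence V_0 = 0, V_1 = 1,
    V_(k+2) = y V_(k+1) - V_k. If y = x + 1/x, then V_k is
    (x^k - x^(-k)) / (x - 1/x). At y = -1, where x is a primitive cube root of
    unity, it is 0, 1, -1 with period 3, and the false theta series is the sum
    over k >= 1 of V_k q^(k^2 - 1) ([falseTheta_Psi]): the indices k = 3n+1
    give its first series and k = 3n+2 its second.

    The factor (q^3;q^3)_n / (q;q)_n of the summand is the value at y = -1 of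
    the product over 1 <= i <= n of 1 - y q^i + q^(2i), that is of
    (xq;q)_n (q/x;q)_n. A finite form of the Jacobi triple product expands this
    product in V_1, ..., V_(n+1) ([quadPoch_expansion]). With k = j + 1, the
    n-th summand of the theorem becomes the sum over j <= n of
    V_(j+1) q^(j^2 + 2j) K(j, n - j) ([term_expansion]), where K is the [kernel]
    below.

    It remains to see that the sum over m of K(j, m) is 1 for each j, and that
    the order of summation may be changed. The first point is an instance of the
    summation of a 1-phi-1 series; the proof is by a Wilf-Zeilberger pair, which
    even gives the partial sums:
    the sum over m <= M of K(j, m) is 1 plus the sum over i <= j of G(i, M)
    ([kernel_sum]), with G the [wzMate]. Since |G(i, M)| is at most a constant
    times |q|^(M + i), the partial sums of the two sides of the theorem differ
    by at most a constant times |q|^M ([kernel_transform]), and only finite sums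
    are ever interchanged. *)

(** * Powers and q-factorials *)

Definition qfact (q : C) (n : nat) : C := qPoch q q n.

Lemma qfact_S (q : C) (n : nat) : qfact q (S n) = qfact q n * (1 - q * q ^ n).
Proof. reflexivity. Qed.

(** The binomial coefficients n(n-1)/2, by recursion so that powers with these
    exponents can be handled without division. *)
Fixpoint tri (n : nat) : nat := match n with O => O | S m => (tri m + m)%nat end.

Lemma tri_double (n : nat) : (2 * tri n + n = n * n)%nat.
Proof. induction n as [|n IH]; simpl tri; nia. Qed.

Lemma Cpow_double (c : C) (n : nat) : c ^ (2 * n) = c ^ n * c ^ n.
Proof. replace (2 * n)%nat with (n + n)%nat by lia. apply Cpow_add_r. Qed.

Lemma pow_unit_interval (r : R) (n : nat) : (0 <= r < 1)%R -> (0 <= r ^ n <= 1)%R.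
Proof.
intros hr. split; [apply pow_le; lra|]. rewrite <- (pow1 n). apply pow_incr. lra.
Qed.

Lemma pow_le_pow (r : R) (m n : nat) : (0 <= r < 1)%R -> (m <= n)%nat -> (r ^ n <= r ^ m)%R.
Proof.
intros hr H. replace n with ((n - m) + m)%nat by lia. rewrite pow_add.
rewrite <- (Rmult_1_l (r ^ m)) at 2. apply Rmult_le_compat_r.
- apply pow_le. lra.
- apply pow_unit_interval. lra.
Qed.

Lemma one_minus_pow_neq_0 (q : C) (n : nat) :
  (Cmod q < 1)%R -> 1 - q * q ^ n <> 0.
Proof.
intros hq E.
assert (H : Cmod (q * q ^ n) = 1%R).
{ replace (q * q ^ n) with (RtoC 1) by (rewrite <- (Cplus_0_l (q * q ^ n)), <- E; ring).
  apply Cmod_1. }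
rewrite Cmod_mult, Cmod_pow in H.
assert (H1 := Cmod_ge_0 q).
assert (H2 := pow_unit_interval (Cmod q) n ltac:(lra)).
nra.
Qed.

Lemma qfact_neq_0 (q : C) (n : nat) : (Cmod q < 1)%R -> qfact q n <> 0.
Proof.
intros hq. induction n as [|n IH].
- exact C1_nz.
- rewrite qfact_S. apply Cmult_neq_0; [exact IH | now apply one_minus_pow_neq_0].
Qed.

(** [sum_n] has its values in the carrier of a canonical structure, which [ring]
    and [field] do not see as [C]. *)
Definition csum (u : nat -> C) (n : nat) : C := sum_n u n.

Lemma csum_0 (u : nat -> C) : csum u 0 = u O.
Proof. exact (sum_O u). Qed.

Lemma csum_S (u : nat -> C) (n : nat) : csum u (S n) = csum u n + u (S n).
Proof. exact (sum_Sn u n). Qed.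

Lemma csum_mult_l (a : C) (u : nat -> C) (n : nat) :
  csum (fun j => a * u j) n = a * csum u n.
Proof. exact (sum_n_mult_l (K := C_Ring) a u n). Qed.

Lemma csum_plus (u v : nat -> C) (n : nat) :
  csum (fun j => u j + v j) n = csum u n + csum v n.
Proof. exact (sum_n_plus u v n). Qed.

Lemma csum_ext (u v : nat -> C) (n : nat) :
  (forall j, (j <= n)%nat -> u j = v j) -> csum u n = csum v n.
Proof. exact (sum_n_ext_loc u v n). Qed.

(** * A Wilf-Zeilberger pair *)

(** The m-th term of the basic hypergeometric series 1-phi-1 with parameters
    a = q^(j+1), c = q^(2j+3) and argument c/a, times the constant
    (1 - q^(j+1)) (q;q)_j / (q;q)_(2j+2) that makes the sum over m equal to 1. *)
Definition kernel (q : C) (j m : nat) : C :=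
  (-1) ^ m * q ^ (tri m + m * (j + 2)) * (1 - q ^ (j + 1)) * qfact q (m + j)
    / (qfact q m * qfact q (m + 2 * j + 2)).

(** Defined so that, for j >= 1, K(j, m) - K(j-1, m) = G(j, m) - G(j, m-1), where
    G(j, -1) = 0. The last factor is the polynomial in q^(m+1), of degree 1,
    that solves this equation. *)
Definition wzMate (q : C) (i m : nat) : C :=
  (-1) ^ (m + 1) * q ^ (tri (m + 1) + (m + 1) * (i + 1)) * qfact q (m + i)
    / (qfact q m * qfact q (m + 2 * i + 2))
    * ((1 - q ^ i) - q ^ i * (1 - q ^ (2 * i + 1)) * q ^ (m + 1)).

(** The denominators left by [field] are those of the hypotheses up to the
    order of the factors, so each is matched by [ring]. *)
Ltac nonzero :=
  cbv beta; repeat split;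
  first
    [ assumption
    | match goal with
      | H : _ <> _ |- _ =>
          intro; apply H;
          match goal with E : _ = RtoC 0 |- _ => rewrite <- E; ring end
      end ].

(** For j = 0 the kernel itself telescopes, to a sum starting from 1. *)
Lemma kernel_0_0 (q : C) : (Cmod q < 1)%R -> kernel q 0 0 = 1 + wzMate q 0 0.
Proof.
intros hq. unfold kernel, wzMate. simpl Nat.add. simpl Nat.mul. simpl tri.
rewrite !qfact_S. change (qfact q 0) with (RtoC 1). simpl Cpow.
assert (H1 := one_minus_pow_neq_0 q 0 hq).
assert (H2 := one_minus_pow_neq_0 q 1 hq). simpl Cpow in H1, H2.
field. nonzero.
Qed.

Lemma kernel_0_S (q : C) (m : nat) :
  (Cmod q < 1)%R -> kernel q 0 (S m) = wzMate q 0 (S m) - wzMate q 0 m.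
Proof.
intros hq. unfold kernel, wzMate.
replace (tri (S m) + S m * (0 + 2))%nat with (tri m + m + m + m + 1 + 1)%nat
  by (simpl tri; lia).
replace (tri (S m + 1) + (S m + 1) * (0 + 1))%nat with (tri m + m + m + m + 1 + 1 + 1)%nat
  by (rewrite (Nat.add_1_r (S m)); simpl tri; lia).
replace (tri (m + 1) + (m + 1) * (0 + 1))%nat with (tri m + m + m + 1)%nat
  by (rewrite (Nat.add_1_r m); simpl tri; lia).
replace (S m + 2 * 0 + 2)%nat with (S (S (S m))) by lia.
replace (m + 2 * 0 + 2)%nat with (S (S m)) by lia.
replace (S m + 0)%nat with (S m) by lia.
replace (m + 0)%nat with m by lia.
rewrite !qfact_S, !Cpow_add_r, !Cpow_S.
change (q ^ 0) with (RtoC 1).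
assert (H0 := qfact_neq_0 q m hq).
assert (H1 := one_minus_pow_neq_0 q m hq).
assert (H2 := one_minus_pow_neq_0 q (S m) hq).
assert (H3 := one_minus_pow_neq_0 q (S (S m)) hq). rewrite !Cpow_S in H2, H3.
revert H0 H1 H2 H3. simpl Cpow.
generalize (q ^ tri m) (q ^ m) ((-1) ^ m) (qfact q m). intros.
field. nonzero.
Qed.

Lemma kernel_S_0 (q : C) (j : nat) :
  (Cmod q < 1)%R -> kernel q (S j) 0 - kernel q j 0 = wzMate q (S j) 0.
Proof.
intros hq. unfold kernel, wzMate.
replace (0 + 2 * S j + 2)%nat with (S (S (S (S (2 * j))))) by lia.
replace (0 + 2 * j + 2)%nat with (S (S (2 * j))) by lia.
replace (2 * S j + 1)%nat with (S (S (S (2 * j)))) by lia.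
replace (tri (0 + 1) + (0 + 1) * (S j + 1))%nat with (S (S j)) by (simpl; lia).
simpl (tri 0 + _)%nat. simpl (0 + _)%nat. change (qfact q 0) with (RtoC 1).
rewrite !qfact_S, !Nat.add_1_r.
assert (H0 := qfact_neq_0 q (2 * j) hq).
assert (H1 := one_minus_pow_neq_0 q (2 * j) hq).
assert (H2 := one_minus_pow_neq_0 q (S (2 * j)) hq).
assert (H3 := one_minus_pow_neq_0 q (S (S (2 * j))) hq).
assert (H4 := one_minus_pow_neq_0 q (S (S (S (2 * j)))) hq).
revert H0 H1 H2 H3 H4. rewrite ?Cpow_S, ?Cpow_double. change (q ^ 0) with (RtoC 1).
generalize (q ^ j) (qfact q j) (qfact q (2 * j)). intros.
field. nonzero.
Qed.

Lemma kernel_S_S (q : C) (j m : nat) :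
  (Cmod q < 1)%R ->
  kernel q (S j) (S m) - kernel q j (S m) = wzMate q (S j) (S m) - wzMate q (S j) m.
Proof.
intros hq. unfold kernel, wzMate.
replace (tri (S m) + S m * (S j + 2))%nat
  with (tri m + m * j + m + m + m + m + j + 1 + 1 + 1)%nat
  by (simpl tri; lia).
replace (tri (S m) + S m * (j + 2))%nat
  with (tri m + m * j + m + m + m + j + 1 + 1)%nat
  by (simpl tri; lia).
replace (tri (S m + 1) + (S m + 1) * (S j + 1))%nat
  with (tri m + m * j + m + m + m + m + j + j + 1 + 1 + 1 + 1 + 1)%nat
  by (rewrite (Nat.add_1_r (S m)); simpl tri; lia).
replace (tri (m + 1) + (m + 1) * (S j + 1))%nat
  with (tri m + m * j + m + m + m + j + 1 + 1)%nat
  by (rewrite (Nat.add_1_r m); simpl tri; lia).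
replace (S m + 2 * S j + 2)%nat with (S (S (S (S (S (m + 2 * j)))))) by lia.
replace (S m + 2 * j + 2)%nat with (S (S (S (m + 2 * j)))) by lia.
replace (m + 2 * S j + 2)%nat with (S (S (S (S (m + 2 * j))))) by lia.
replace (2 * S j + 1)%nat with (S (S (S (2 * j)))) by lia.
replace (S m + S j)%nat with (S (S (m + j))) by lia.
replace (m + S j)%nat with (S (m + j)) by lia.
replace (S m + j)%nat with (S (m + j)) by lia.
rewrite !qfact_S.
assert (H0 := qfact_neq_0 q (m + 2 * j) hq).
assert (H5 := qfact_neq_0 q m hq).
assert (H6 := one_minus_pow_neq_0 q m hq).
assert (H1 := one_minus_pow_neq_0 q (m + 2 * j) hq).
assert (H2 := one_minus_pow_neq_0 q (S (m + 2 * j)) hq).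
assert (H3 := one_minus_pow_neq_0 q (S (S (m + 2 * j))) hq).
assert (H4 := one_minus_pow_neq_0 q (S (S (S (m + 2 * j)))) hq).
assert (H7 := one_minus_pow_neq_0 q (S (S (S (S (m + 2 * j))))) hq).
revert H0 H1 H2 H3 H4 H5 H6 H7.
rewrite ?Cpow_add_r, ?Cpow_S, ?Cpow_add_r, ?Cpow_double, ?Cpow_1_r.
generalize (q ^ j) (q ^ m) (q ^ tri m) (q ^ (m * j)) ((-1) ^ m) (qfact q m)
  (qfact q (m + j)) (qfact q (m + 2 * j)). intros.
field. nonzero.
Qed.

(** Induction on j, each step of which telescopes in m. *)
Lemma kernel_sum (q : C) (j M : nat) :
  (Cmod q < 1)%R -> csum (kernel q j) M = 1 + csum (fun i => wzMate q i M) j.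
Proof.
intros hq. induction j as [|j IHj].
- rewrite csum_0. induction M as [|M IH].
  + rewrite csum_0. now apply kernel_0_0.
  + rewrite csum_S, IH, kernel_0_S by exact hq. ring.
- rewrite csum_S, Cplus_assoc, <- IHj. clear IHj. induction M as [|M IH].
  + rewrite !csum_0, <- kernel_S_0 by exact hq. ring.
  + rewrite !csum_S, IH.
    replace (wzMate q (S j) (S M))
      with (kernel q (S j) (S M) - kernel q j (S M) + wzMate q (S j) M)
      by (rewrite kernel_S_S by exact hq; ring).
    ring.
Qed.

(** * Expansion in the Lucas sequence *)

(** The coefficient of V_k in (xq;q)_(N-1) (q/x;q)_(N-1) (1 - q^N) / (q;q)_(2N),
    where y = x + 1/x. In x - 1/x times this product, the coefficient of x^k is,
    by the finite Jacobi triple product, a combination of two adjacent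
    q-binomial coefficients, which simplifies to the single quotient below.
    The truncated N - k makes the test k <= N necessary. *)
Definition lucasCoef (q : C) (N k : nat) : C :=
  if (k <=? N)%nat
  then (-1) ^ (k + 1) * q ^ tri k * (1 - q ^ k)
         / (qfact q (N - k) * qfact q (N + k))
  else 0.

(** The recurrence expresses multiplication by the factor
    1 - y q^N + q^(2N), since y V_k = V_(k+1) + V_(k-1). *)
Lemma lucasCoef_rec (q : C) (N k : nat) :
  (Cmod q < 1)%R ->
  (1 - q ^ (2 * N + 1)) * (1 + q ^ (N + 1)) * (1 - q ^ N) * lucasCoef q (S N) (S k) =
  (1 + q ^ (2 * N)) * lucasCoef q N (S k)
  - q ^ N * (lucasCoef q N k + lucasCoef q N (S (S k))).
Proof.
intros hq. unfold lucasCoef.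
destruct (Nat.leb_spec (S k) (S N)) as [H|H].
2: { rewrite !(proj2 (Nat.leb_gt _ _)) by lia. ring. }
rewrite (proj2 (Nat.leb_le k N)) by lia.
(* For k = N and for k + 1 = N, some of the neighbours have index above N. *)
destruct (Nat.eq_dec k N) as [->|Hk]; [|destruct (Nat.eq_dec (S k) N) as [<-|Hk']].
- rewrite !(proj2 (Nat.leb_gt _ _)) by lia.
  rewrite !Nat.sub_diag. change (qfact q 0) with (RtoC 1).
  replace (S N + S N)%nat with (S (S (2 * N))) by lia.
  replace (N + N)%nat with (2 * N)%nat by lia.
  rewrite !qfact_S. simpl tri.
  assert (H0 := qfact_neq_0 q (2 * N) hq).
  assert (H1 := one_minus_pow_neq_0 q (2 * N) hq).
  assert (H2 := one_minus_pow_neq_0 q (S (2 * N)) hq).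
  revert H0 H1 H2.
  rewrite ?Cpow_add_r, ?Cpow_S, ?Cpow_double, ?Cpow_add_r, ?Cpow_1_r.
  generalize (q ^ N) (q ^ tri N) ((-1) ^ N) (qfact q (2 * N)). intros.
  field. nonzero.
- rewrite (proj2 (Nat.leb_le _ _)) by lia. rewrite (proj2 (Nat.leb_gt _ _)) by lia.
  rewrite !Nat.sub_diag. change (qfact q 0) with (RtoC 1).
  replace (S (S k) - S k)%nat with 1%nat by lia.
  replace (S k - k)%nat with 1%nat by lia.
  replace (S (S k) + S k)%nat with (S (S (S (2 * k)))) by lia.
  replace (S k + S k)%nat with (S (S (2 * k))) by lia.
  replace (S k + k)%nat with (S (2 * k)) by lia.
  replace (2 * S k)%nat with (S (S (2 * k))) by lia.
  rewrite !qfact_S. change (qfact q 0) with (RtoC 1). simpl tri.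
  assert (H0 := qfact_neq_0 q (2 * k) hq).
  assert (H1 := one_minus_pow_neq_0 q (2 * k) hq).
  assert (H2 := one_minus_pow_neq_0 q (S (2 * k)) hq).
  assert (H3 := one_minus_pow_neq_0 q (S (S (2 * k))) hq).
  assert (H4 := one_minus_pow_neq_0 q 0 hq).
  revert H0 H1 H2 H3 H4.
  rewrite ?Cpow_add_r, ?Cpow_S, ?Cpow_double, ?Cpow_add_r, ?Cpow_1_r.
  change (q ^ 0) with (RtoC 1).
  generalize (q ^ k) (q ^ tri k) ((-1) ^ k) (qfact q (2 * k)). intros.
  field. nonzero.
- rewrite !(proj2 (Nat.leb_le _ _)) by lia.
  destruct (Nat.le_exists_sub (S (S k)) N) as [p [-> _]]; [lia|].
  replace (S (p + S (S k)) - S k)%nat with (S (S p)) by lia.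
  replace (p + S (S k) - S k)%nat with (S p) by lia.
  replace (p + S (S k) - k)%nat with (S (S p)) by lia.
  replace (p + S (S k) - S (S k))%nat with p by lia.
  replace (S (p + S (S k)) + S k)%nat with (S (S (S (S (p + 2 * k))))) by lia.
  replace (p + S (S k) + S k)%nat with (S (S (S (p + 2 * k)))) by lia.
  replace (p + S (S k) + k)%nat with (S (S (p + 2 * k))) by lia.
  replace (p + S (S k) + S (S k))%nat with (S (S (S (S (p + 2 * k))))) by lia.
  replace (2 * (p + S (S k)))%nat with (S (S (S (S (2 * p + 2 * k))))) by lia.
  replace (p + S (S k))%nat with (S (S (p + k))) by lia.
  rewrite !qfact_S. simpl tri.
  assert (H0 := qfact_neq_0 q (p + 2 * k) hq).
  assert (H1 := one_minus_pow_neq_0 q (p + 2 * k) hq).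
  assert (H2 := one_minus_pow_neq_0 q (S (p + 2 * k)) hq).
  assert (H3 := one_minus_pow_neq_0 q (S (S (p + 2 * k))) hq).
  assert (H4 := one_minus_pow_neq_0 q (S (S (S (p + 2 * k)))) hq).
  assert (H5 := qfact_neq_0 q p hq).
  assert (H6 := one_minus_pow_neq_0 q p hq).
  assert (H7 := one_minus_pow_neq_0 q (S p) hq).
  revert H0 H1 H2 H3 H4 H5 H6 H7.
  rewrite ?Cpow_add_r, ?Cpow_S, ?Cpow_add_r, ?Cpow_double, ?Cpow_1_r.
  generalize (q ^ k) (q ^ p) (q ^ tri k) ((-1) ^ k) (qfact q p) (qfact q (p + 2 * k)).
  intros.
  field. nonzero.
Qed.

Lemma Cmult_cancel_l (a x y : C) : a <> 0 -> a * x = a * y -> x = y.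
Proof.
intros ha E. replace x with (/ a * (a * x)) by (field; exact ha).
rewrite E. field. exact ha.
Qed.

Fixpoint lucas (y : C) (n : nat) : C :=
  match n with
  | O => 0
  | S m => match m with O => 1 | S p => y * lucas y m - lucas y p end
  end.

Lemma lucas_SS (y : C) (n : nat) : lucas y (S (S n)) = y * lucas y (S n) - lucas y n.
Proof. reflexivity. Qed.

(** Summation by parts from y V_k = V_(k+1) + V_(k-1). *)
Lemma lucas_shift (y : C) (a : nat -> C) (n : nat) :
  y * csum (fun j => a (S j) * lucas y (S j)) n =
  csum (fun j => (a j + a (S (S j))) * lucas y (S j)) n
  + a (S n) * lucas y (S (S n)) - a (S (S n)) * lucas y (S n) - a O.
Proof.
induction n as [|n IH].
- rewrite !csum_0. simpl lucas. ring.
- rewrite !csum_S, Cmult_plus_distr_l, IH, (lucas_SS y (S n)). ring.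
Qed.

(** With y = x + 1/x this is (xq;q)_n (q/x;q)_n. *)
Fixpoint quadPoch (y q : C) (n : nat) : C :=
  match n with
  | O => 1
  | S m => quadPoch y q m * (1 - y * q ^ S m + q ^ (2 * S m))
  end.

Lemma lucasCoef_0 (q : C) (N : nat) : lucasCoef q N 0 = 0.
Proof. unfold lucasCoef. simpl. unfold Cdiv. ring. Qed.

Lemma lucasCoef_gt (q : C) (N k : nat) : (N < k)%nat -> lucasCoef q N k = 0.
Proof. intros H. unfold lucasCoef. now rewrite (proj2 (Nat.leb_gt _ _) H). Qed.

(** The finite Jacobi triple product, in a form symmetric under x -> 1/x. Both
    sides are multiplied by the same factor when n increases, by
    [lucasCoef_rec] and [lucas_shift]. *)
Lemma quadPoch_expansion (y q : C) (n : nat) :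
  (Cmod q < 1)%R ->
  quadPoch y q n * (1 - q ^ (n + 1)) / qfact q (2 * n + 2) =
  csum (fun j => lucasCoef q (S n) (S j) * lucas y (S j)) n.
Proof.
intros hq. induction n as [|n IH].
- rewrite csum_0. unfold lucasCoef. simpl Nat.leb. simpl Nat.add. simpl Nat.sub. simpl Nat.mul.
  cbv iota. simpl tri. simpl lucas. simpl quadPoch. simpl Cpow.
  rewrite !qfact_S. change (qfact q 0) with (RtoC 1).
  assert (H1 := one_minus_pow_neq_0 q 0 hq).
  assert (H2 := one_minus_pow_neq_0 q 1 hq). simpl Cpow in *.
  field. nonzero.
- set (N := S n) in *.
  assert (E : (1 - q ^ (2 * N + 1)) * (1 + q ^ (N + 1)) * (1 - q ^ N)
    * csum (fun j => lucasCoef q (S N) (S j) * lucas y (S j)) N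
    = (1 + q ^ (2 * N) - y * q ^ N)
    * csum (fun j => lucasCoef q N (S j) * lucas y (S j)) n).
  { assert (E0 : csum (fun j => lucasCoef q N (S j) * lucas y (S j)) n
                 = csum (fun j => lucasCoef q N (S j) * lucas y (S j)) N).
    { transitivity (csum (fun j => lucasCoef q N (S j) * lucas y (S j)) (S n)); [|reflexivity].
      rewrite csum_S, (lucasCoef_gt q N (S (S n))) by (unfold N; lia). ring. }
    rewrite E0.
    replace ((1 + q ^ (2 * N) - y * q ^ N)
      * csum (fun j => lucasCoef q N (S j) * lucas y (S j)) N)
      with ((1 + q ^ (2 * N)) * csum (fun j => lucasCoef q N (S j) * lucas y (S j)) N
        + - q ^ N * (y * csum (fun j => lucasCoef q N (S j) * lucas y (S j)) N)) by ring.
    rewrite lucas_shift, lucasCoef_0, !(lucasCoef_gt q N) by lia.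
    transitivity ((1 + q ^ (2 * N)) * csum (fun j => lucasCoef q N (S j) * lucas y (S j)) N
      + - q ^ N * csum (fun j => (lucasCoef q N j + lucasCoef q N (S (S j))) * lucas y (S j)) N);
      [|ring].
    rewrite <- !csum_mult_l, <- csum_plus.
    apply csum_ext. intros j _.
    rewrite Cmult_assoc, lucasCoef_rec by exact hq.
    ring. }
  rewrite <- IH in E. clear IH.
  assert (H0 := qfact_neq_0 q (2 * N) hq).
  assert (H1 := one_minus_pow_neq_0 q (2 * N) hq).
  assert (H2 := one_minus_pow_neq_0 q (S (2 * N)) hq).
  assert (H3 := one_minus_pow_neq_0 q n hq).
  (* This factor divides 1 - q^(2N+2). *)
  assert (H4 : 1 + q ^ (N + 1) <> 0).
  { intros E'. apply H2. rewrite Cpow_S, Cpow_double.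
    rewrite Nat.add_1_r, Cpow_S in E'.
    transitivity ((1 - q * q ^ N) * (1 + q * q ^ N)); [ring | rewrite E'; ring]. }
  replace (2 * n + 2)%nat with (2 * N)%nat in E by (unfold N; lia).
  replace (n + 1)%nat with N in E by (unfold N; lia).
  change (1 - q ^ N <> 0) in H3.
  replace (2 * N + 2)%nat with (S (S (2 * N))) by lia.
  apply Cmult_cancel_l with ((1 - q ^ (2 * N + 1)) * (1 + q ^ (N + 1)) * (1 - q ^ N)).
  2: { rewrite E.
    change (quadPoch y q N) with (quadPoch y q n * (1 - y * q ^ N + q ^ (2 * N))).
    rewrite !qfact_S. revert H0 H1 H2 H3 H4.
    rewrite ?Cpow_add_r, ?Cpow_S, ?Cpow_double, ?Cpow_1_r.
    generalize (q ^ N) (quadPoch y q n) (qfact q (2 * N)). intros.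
    field. nonzero. }
  apply Cmult_neq_0; [apply Cmult_neq_0|]; try assumption.
  rewrite Nat.add_1_r, Cpow_S. exact H1.
Qed.

(** * Estimates and the exchange of summation *)

Lemma csum_triangle (v : nat -> C) (k : nat -> nat -> C) (M : nat) :
  csum (fun n => csum (fun j => v j * k j (n - j)%nat) n) M =
  csum (fun j => v j * csum (k j) (M - j)) M.
Proof.
induction M as [|M IH].
- rewrite !csum_0. reflexivity.
- rewrite csum_S, IH, !csum_S, Nat.sub_diag, csum_0, Cplus_assoc. f_equal.
  rewrite <- csum_plus.
  apply csum_ext. intros j Hj.
  replace (S M - j)%nat with (S (M - j)) by lia.
  rewrite csum_S. ring.
Qed.

Lemma csum_geometric_bound (u : nat -> C) (A r : R) (n : nat) :
  (0 <= r < 1)%R -> (0 <= A)%R ->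
  (forall i, (i <= n)%nat -> (Cmod (u i) <= A * r ^ i)%R) ->
  (Cmod (csum u n) <= A / (1 - r))%R.
Proof.
intros hr hA H.
assert (G : forall k, (k <= n)%nat ->
  (Cmod (csum u k) <= A / (1 - r) * (1 - r ^ S k))%R).
{ induction k as [|k IH]; intros Hk.
  - rewrite csum_0. apply Rle_trans with (1 := H O Hk). apply Req_le. simpl. field. lra.
  - rewrite csum_S. apply Rle_trans with (1 := Cmod_triangle _ _).
    apply Rle_trans with (1 := Rplus_le_compat _ _ _ _ (IH ltac:(lia)) (H (S k) Hk)).
    apply Req_le. simpl. field. lra. }
apply Rle_trans with (1 := G n (le_n n)).
assert (0 <= A / (1 - r))%R by (apply Rdiv_le_0_compat; lra).
assert (0 <= r ^ S n)%R by (apply pow_le; lra).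
nra.
Qed.

(** With r = |q|, each factor has modulus between 1 - r^(n+1) and 1 + r^(n+1),
    hence between exp(-x) and exp(x) for x = r^(n+1) / (1 - r), and these x have
    the finite sum r / (1 - r)^2. *)
Lemma qfact_bounds (q : C) :
  (Cmod q < 1)%R ->
  exists B : R, (0 < B)%R /\
    forall n, (/ B <= Cmod (qfact q n) <= B)%R.
Proof.
intros hq. set (r := Cmod q) in *.
assert (hr : (0 <= r)%R) by apply Cmod_ge_0.
exists (exp (r / (1 - r) ^ 2)). split; [apply exp_pos|]. intros n.
set (s := fun n => (r * (1 - r ^ n) / (1 - r) ^ 2)%R).
assert (hp : forall n, (0 <= r ^ n <= 1)%R) by (intros k; apply pow_unit_interval; lra).
assert (G : (exp (- s n) <= Cmod (qfact q n) <= exp (s n))%R).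
{ induction n as [|n IH].
  - unfold s. change (qfact q 0) with (RtoC 1). rewrite Cmod_1. simpl.
    replace (r * (1 - 1) / ((1 - r) * ((1 - r) * 1)))%R with 0%R by (field; lra).
    rewrite Ropp_0, exp_0. lra.
  - rewrite qfact_S, Cmod_mult. set (x := (r * r ^ n)%R).
    assert (hx : (0 <= x <= r)%R) by (unfold x; specialize (hp n); nra).
    assert (hs : s (S n) = (s n + x / (1 - r))%R) by (unfold s, x; simpl; field; lra).
    assert (hz : Cmod (q * q ^ n) = x) by (unfold x, r; now rewrite Cmod_mult, Cmod_pow).
    assert (hc : (x <= x / (1 - r))%R).
    { apply Rmult_le_reg_r with (1 - r)%R; [lra|].
      replace (x / (1 - r) * (1 - r))%R with x by (field; lra). nra. }
    assert (h1 : (Cmod (1 - q * q ^ n) <= exp (x / (1 - r)))%R).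
    { apply Rle_trans with (1 := Cmod_triangle _ _).
      rewrite Cmod_opp, Cmod_1, hz.
      apply Rle_trans with (2 := exp_ineq1_le _). lra. }
    assert (h2 : (1 - x <= Cmod (1 - q * q ^ n))%R).
    { assert (T := Cmod_triangle (1 - q * q ^ n) (q * q ^ n)).
      replace (1 - q * q ^ n + q * q ^ n) with (RtoC 1) in T by ring.
      rewrite Cmod_1, hz in T. lra. }
    (* This is 1 / (1 - x) <= 1 + x / (1 - r) <= exp (x / (1 - r)), as x <= r. *)
    assert (h3 : (exp (- (x / (1 - r))) <= 1 - x)%R).
    { rewrite exp_Ropp. apply Rmult_le_reg_r with (exp (x / (1 - r))); [apply exp_pos|].
      rewrite Rinv_l by (apply Rgt_not_eq, exp_pos).
      apply Rle_trans with ((1 - x) * (1 + x / (1 - r)))%R.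
      - replace ((1 - x) * (1 + x / (1 - r)))%R
          with (1 + x * (r - x) / (1 - r))%R by (field; lra).
        assert (0 <= x * (r - x) / (1 - r))%R by (apply Rdiv_le_0_compat; nra). lra.
      - apply Rmult_le_compat_l; [lra | apply exp_ineq1_le]. }
    rewrite hs, Ropp_plus_distr, !exp_plus.
    split; apply Rmult_le_compat;
      try apply Cmod_ge_0; try apply Rlt_le, exp_pos; lra. }
assert (hsn : (s n <= r / (1 - r) ^ 2)%R).
{ unfold s, Rdiv. apply Rmult_le_compat_r.
  - apply Rlt_le, Rinv_0_lt_compat, pow_lt. lra.
  - specialize (hp n). nra. }
assert (E : forall a b, (a <= b)%R -> (exp a <= exp b)%R).
{ intros a b [h| ->]; [left; now apply exp_increasing | right; reflexivity]. }
rewrite <- exp_Ropp. split.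
- apply Rle_trans with (2 := proj1 G). apply E. lra.
- apply Rle_trans with (1 := proj2 G). now apply E.
Qed.

(** The exponent of q in G(i, m) is at least m + i; all other factors are
    bounded. *)
Lemma wzMate_bound (q : C) :
  (Cmod q < 1)%R ->
  exists A : R, (0 <= A)%R /\
    forall i m, (Cmod (wzMate q i m) <= A * Cmod q ^ m * Cmod q ^ i)%R.
Proof.
intros hq. destruct (qfact_bounds q hq) as [B [hB HB]].
exists (4 * (B * (B * B)))%R. split; [apply Rmult_le_pos; [lra|]; repeat apply Rmult_le_pos; lra|].
intros i m. set (r := Cmod q) in *.
assert (hr : (0 <= r)%R) by apply Cmod_ge_0.
assert (hp : forall n, (0 <= r ^ n <= 1)%R) by (intros k; apply pow_unit_interval; lra).
assert (hQ : forall n, (Cmod (/ qfact q n) <= B)%R).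
{ intros n. rewrite Cmod_inv by now apply qfact_neq_0.
  rewrite <- (Rinv_inv B). apply Rinv_le_contravar.
  - now apply Rinv_0_lt_compat.
  - apply HB. }
assert (hq1 : forall n, (Cmod (q ^ n) <= 1)%R).
{ intros n. rewrite Cmod_pow. apply hp. }
assert (hd : forall n, (Cmod (1 - q ^ n) <= 2)%R).
{ intros n. apply Rle_trans with (1 := Cmod_triangle _ _).
  rewrite Cmod_opp, Cmod_1. specialize (hq1 n). lra. }
assert (hs : forall n, Cmod ((-1) ^ n) = 1%R).
{ intros n. rewrite Cmod_pow.
  replace (Cmod (-1)) with 1%R; [apply pow1|]. rewrite Cmod_R, Rabs_left; lra. }
unfold wzMate, Cdiv.
replace (tri (m + 1) + (m + 1) * (i + 1))%nat with ((m + i) + (tri (m + 1) + m * i + 1))%nat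
  by lia.
replace (/ (qfact q m * qfact q (m + 2 * i + 2)))
  with (/ qfact q m * / qfact q (m + 2 * i + 2))
  by (field; split; now apply qfact_neq_0).
rewrite (Cpow_add_r q (m + i)).
set (P := 1 - q ^ i - q ^ i * (1 - q ^ (2 * i + 1)) * q ^ (m + 1)).
assert (hP : (Cmod P <= 4)%R).
{ unfold P. apply Rle_trans with (1 := Cmod_triangle _ _).
  rewrite Cmod_opp, !Cmod_mult.
  assert (Cmod (q ^ i) * Cmod (1 - q ^ (2 * i + 1)) * Cmod (q ^ (m + 1)) <= 1 * 2 * 1)%R.
  { repeat (apply Rmult_le_compat; [| apply Cmod_ge_0 | | auto]);
      repeat apply Rmult_le_pos; try apply Cmod_ge_0; auto. }
  specialize (hd i). lra. }
rewrite !Cmod_mult, hs, (Cmod_pow q (m + i)), pow_add. fold r.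
replace (4 * (B * (B * B)) * r ^ m * r ^ i)%R
  with (1 * (r ^ m * r ^ i * 1) * B * (B * B) * 4)%R by ring.
repeat (apply Rmult_le_compat;
  [ repeat (apply Rmult_le_pos || apply Cmod_ge_0 || apply hp || lra)
  | repeat (apply Rmult_le_pos || apply Cmod_ge_0 || apply hp || lra) | | ]);
  try apply Rle_refl; auto; apply HB.
Qed.

Lemma kernel_csum_bound (q : C) :
  (Cmod q < 1)%R ->
  exists A : R, (0 <= A)%R /\
    forall j M, (Cmod (csum (kernel q j) M - 1) <= A * Cmod q ^ M)%R.
Proof.
intros hq. destruct (wzMate_bound q hq) as [A [hA HA]].
set (r := Cmod q) in *.
assert (hr : (0 <= r)%R) by apply Cmod_ge_0.
exists (A / (1 - r))%R. split; [apply Rdiv_le_0_compat; lra|].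
intros j M. rewrite kernel_sum by exact hq.
replace (1 + csum (fun i => wzMate q i M) j - 1) with (csum (fun i => wzMate q i M) j) by ring.
replace (A / (1 - r) * r ^ M)%R with (A * r ^ M / (1 - r))%R by (field; lra).
apply csum_geometric_bound; [lra | | intros i _; apply HA].
apply Rmult_le_pos; [exact hA | now apply pow_le].
Qed.

(** The partial sums up to M of the two series differ by the sum over j <= M of
    v_j times the error of the partial sum of K(j, .) up to M - j, which is
    O(|q|^(M-j)). The hypothesis on v turns |q|^(M-j) into |q|^(M+j), whose sum
    over j is O(|q|^M). *)
Lemma kernel_transform (q : C) (v : nat -> C) (l : C) :
  (Cmod q < 1)%R ->
  (forall j, (Cmod (v j) <= Cmod q ^ (2 * j))%R) ->
  is_series v l ->
  is_series (fun n => csum (fun j => v j * kernel q j (n - j)) n) l.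
Proof.
intros hq hv Hv. destruct (kernel_csum_bound q hq) as [A [hA HA]].
set (r := Cmod q) in *.
assert (hr : (0 <= r)%R) by apply Cmod_ge_0.
set (D := fun M => csum (fun j => v j * (csum (kernel q j) (M - j) - 1)) M).
assert (HD : forall M, (Cmod (D M) <= A / (1 - r) * r ^ M)%R).
{ intros M. replace (A / (1 - r) * r ^ M)%R with (A * r ^ M / (1 - r))%R by (field; lra).
  apply csum_geometric_bound; [lra | |].
  { apply Rmult_le_pos; [exact hA | now apply pow_le]. }
  intros j Hj. rewrite Cmod_mult.
  replace (A * r ^ M * r ^ j)%R with (r ^ (2 * j) * (A * r ^ (M - j)))%R.
  - apply Rmult_le_compat; auto using Cmod_ge_0.
  - replace (A * r ^ M * r ^ j)%R with (A * (r ^ M * r ^ j))%R by ring.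
    rewrite <- pow_add. replace (M + j)%nat with (2 * j + (M - j))%nat by lia.
    rewrite pow_add. ring. }
assert (HD0 : filterlim D eventually (locally (RtoC 0))).
{ apply (filterlim_norm_zero (K := C_AbsRing) (V := C_NormedModule)).
  apply (is_lim_seq_le_le (fun _ => 0%R) (fun M => Cmod (D M))
           (fun M => A / (1 - r) * r ^ M)%R (Finite 0)).
  - intros M. split; [apply Cmod_ge_0 | apply HD].
  - apply is_lim_seq_const.
  - evar_last.
    + apply is_lim_seq_mult'; [apply is_lim_seq_const | apply is_lim_seq_geom].
      rewrite Rabs_pos_eq; assumption.
    + f_equal. ring. }
replace l with (l + 0) by ring.
apply filterlim_ext with (fun M => plus (sum_n v M) (D M)).
{ intros M. change (csum v M + D M
    = csum (fun n => csum (fun j => v j * kernel q j (n - j)) n) M).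
  rewrite csum_triangle. unfold D. rewrite <- csum_plus.
  apply csum_ext. intros j _. ring. }
eapply filterlim_comp_2; [exact Hv | exact HD0 |].
exact (filterlim_plus (V := C_NormedModule) l (RtoC 0)).
Qed.

(** * The false theta series *)

(** Since 1 - z^3 = (1 - z)(1 + z + z^2). *)
Lemma quadPoch_cube (q : C) (n : nat) :
  qPoch (q ^ 3) (q ^ 3) n = quadPoch (-1) q n * qfact q n.
Proof.
induction n as [|n IH].
- simpl. change (qfact q 0) with (RtoC 1). ring.
- rewrite qfact_S.
  change (qPoch (q ^ 3) (q ^ 3) n * (1 - q ^ 3 * (q ^ 3) ^ n) =
    quadPoch (-1) q n * (1 - (-1) * q ^ S n + q ^ (2 * S n))
    * (qfact q n * (1 - q * q ^ n))).
  rewrite IH, Cpow_double, <- Cpow_mult_r, (Nat.mul_comm 3 n), Cpow_mult_r, (Cpow_S q n).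
  ring.
Qed.

Lemma tri_add (m n : nat) : tri (m + n) = (tri m + tri n + m * n)%nat.
Proof.
assert (H1 := tri_double m). assert (H2 := tri_double n).
assert (H3 := tri_double (m + n)). nia.
Qed.

Lemma sign_square (n : nat) : (-1) ^ n * (-1) ^ n = 1.
Proof.
rewrite <- Cpow_mult_l. replace (-1 * -1) with (RtoC 1) by ring. apply Cpow_1_l.
Qed.

Lemma lucasCoef_kernel (q : C) (n j : nat) :
  (Cmod q < 1)%R -> (j <= n)%nat ->
  (-1) ^ n * q ^ (tri n + 2 * n) * qfact q n * lucasCoef q (S n) (S j) =
  q ^ (j * j + 2 * j) * kernel q j (n - j).
Proof.
intros hq Hj. destruct (Nat.le_exists_sub j n Hj) as [p [-> _]].
replace (p + j - j)%nat with p by lia.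
unfold lucasCoef, kernel. rewrite (proj2 (Nat.leb_le _ _)) by lia.
replace (S (p + j) - S j)%nat with p by lia.
replace (S (p + j) + S j)%nat with (p + 2 * j + 2)%nat by lia.
assert (E : (-1) ^ (p + j) * (-1) ^ (S j + 1) = (-1) ^ p).
{ rewrite Nat.add_1_r, !Cpow_S, Cpow_add_r.
  transitivity ((-1) ^ p * ((-1) ^ j * (-1) ^ j)); [ring|].
  rewrite sign_square. ring. }
assert (E' : q ^ (tri (p + j) + 2 * (p + j)) * q ^ tri (S j) =
             q ^ (j * j + 2 * j) * q ^ (tri p + p * (j + 2))).
{ rewrite <- !Cpow_add_r. f_equal. rewrite tri_add. simpl tri.
  assert (H := tri_double j). lia. }
rewrite <- E. rewrite (Nat.add_1_r j).
transitivity ((-1) ^ (p + j) * (-1) ^ (S j + 1)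
  * (q ^ (tri (p + j) + 2 * (p + j)) * q ^ tri (S j)) * (1 - q ^ S j)
  * qfact q (p + j) / (qfact q p * qfact q (p + 2 * j + 2))).
- field. split; now apply qfact_neq_0.
- rewrite E'. field. split; now apply qfact_neq_0.
Qed.

Definition falseThetaTerm (q : C) (j : nat) : C := lucas (-1) (S j) * q ^ (j * j + 2 * j).

Lemma term_expansion (q : C) (n : nat) :
  (Cmod q < 1)%R ->
  (-1) ^ n * q ^ (n * (n + 3) / 2) * qPoch (q ^ 3) (q ^ 3) n
    * (1 - q ^ (n + 1)) / qPoch q q (2 * n + 2)
  = csum (fun j => falseThetaTerm q j * kernel q j (n - j)) n.
Proof.
intros hq.
replace (n * (n + 3) / 2)%nat with (tri n + 2 * n)%nat.
2: { apply Nat.div_unique with 0%nat; [lia|]. assert (H := tri_double n). lia. }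
rewrite quadPoch_cube. fold (qfact q (2 * n + 2)).
transitivity ((-1) ^ n * q ^ (tri n + 2 * n) * qfact q n
  * (quadPoch (-1) q n * (1 - q ^ (n + 1)) / qfact q (2 * n + 2))).
{ field. now apply qfact_neq_0. }
rewrite quadPoch_expansion, <- csum_mult_l by exact hq.
apply csum_ext. intros j Hj. unfold falseThetaTerm.
rewrite Cmult_assoc, lucasCoef_kernel by assumption. ring.
Qed.

Lemma lucas_period (n : nat) : lucas (-1) (S (S (S n))) = lucas (-1) n.
Proof. rewrite !lucas_SS. ring. Qed.

Lemma lucas_mod_3 (n : nat) :
  lucas (-1) (3 * n) = 0 /\ lucas (-1) (S (3 * n)) = 1 /\
  lucas (-1) (S (S (3 * n))) = -1.
Proof.
induction n as [|n [IH0 [IH1 IH2]]].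
- simpl lucas. repeat split. ring.
- replace (3 * S n)%nat with (S (S (S (3 * n)))) by lia.
  now rewrite !lucas_period.
Qed.

Lemma lucas_bound (n : nat) : (Cmod (lucas (-1) n) <= 1)%R.
Proof.
rewrite (Nat.div_mod_eq n 3). set (k := (n / 3)%nat).
destruct (lucas_mod_3 k) as [H0 [H1 H2]].
assert (Hm := Nat.mod_upper_bound n 3 ltac:(lia)).
destruct (n mod 3) as [|[|[|m]]].
- rewrite Nat.add_0_r, H0, Cmod_0. lra.
- rewrite Nat.add_1_r, H1, Cmod_1. lra.
- replace (3 * k + 2)%nat with (S (S (3 * k))) by lia.
  rewrite H2, Cmod_R, Rabs_left; lra.
- lia.
Qed.

Lemma falseTheta_bound (q : C) (j : nat) :
  (Cmod q < 1)%R -> (Cmod (falseThetaTerm q j) <= Cmod q ^ (2 * j))%R.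
Proof.
intros hq. unfold falseThetaTerm. rewrite Cmod_mult, Cmod_pow, pow_add.
assert (hr := Cmod_ge_0 q). assert (hl := lucas_bound (S j)).
assert (h0 := Cmod_ge_0 (lucas (-1) (S j))).
assert (h1 := pow_unit_interval (Cmod q) (j * j) ltac:(lra)).
assert (h2 : (0 <= Cmod q ^ (2 * j))%R) by now apply pow_le.
assert (h3 : (Cmod (lucas (-1) (S j)) * Cmod q ^ (j * j) <= 1)%R) by nra.
rewrite <- Rmult_assoc. nra.
Qed.

Lemma ex_cseries_geometric (q : C) (u : nat -> C) :
  (Cmod q < 1)%R -> (forall n, (Cmod (u n) <= Cmod q ^ n)%R) ->
  exists l : C, is_series u l.
Proof.
intros hq H.
apply (ex_series_le (K := C_AbsRing) (V := C_CompleteNormedModule) u (fun n => Cmod q ^ n)%R H).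
apply ex_series_geom. rewrite Rabs_pos_eq; [exact hq | apply Cmod_ge_0].
Qed.

(** The partial sums of the combined series with indices 3N + 2 are those of the
    difference of the two series, because every third term vanishes. *)
Lemma falseTheta_Psi (q : C) :
  (Cmod q < 1)%R -> is_series (falseThetaTerm q) (Psi (q ^ 15) (q ^ 3)).
Proof.
intros hq.
assert (hr : (0 <= Cmod q < 1)%R) by (split; [apply Cmod_ge_0 | exact hq]).
set (a := fun n => (q ^ 15) ^ (n * (n + 1) / 2) * (q ^ 3) ^ (n * (n - 1) / 2)).
set (b := fun k => (q ^ 15) ^ ((k + 1) * k / 2) * (q ^ 3) ^ ((k + 1) * (k + 2) / 2)).
assert (Ha : forall n, a n = q ^ ((3 * n) * (3 * n) + 2 * (3 * n))).
{ intros n. unfold a. rewrite <- !Cpow_mult_r, <- Cpow_add_r. f_equal.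
  assert (T := tri_double n).
  replace (n * (n + 1) / 2)%nat with (tri n + n)%nat
    by (apply Nat.div_unique with 0%nat; lia).
  replace (n * (n - 1) / 2)%nat with (tri n)
    by (apply Nat.div_unique with 0%nat; [lia|]; destruct n; simpl Nat.sub; nia).
  nia. }
assert (Hb : forall n, b n = q ^ ((3 * n + 1) * (3 * n + 1) + 2 * (3 * n + 1))).
{ intros n. unfold b. rewrite <- !Cpow_mult_r, <- Cpow_add_r. f_equal.
  assert (T := tri_double n).
  replace ((n + 1) * n / 2)%nat with (tri n + n)%nat
    by (apply Nat.div_unique with 0%nat; lia).
  replace ((n + 1) * (n + 2) / 2)%nat with (tri n + 2 * n + 1)%nat
    by (apply Nat.div_unique with 0%nat; lia).
  nia. }
destruct (ex_cseries_geometric q a hq) as [la Hla].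
{ intros n. rewrite Ha, Cmod_pow. apply pow_le_pow; [exact hr | nia]. }
destruct (ex_cseries_geometric q b hq) as [lb Hlb].
{ intros n. rewrite Hb, Cmod_pow. apply pow_le_pow; [exact hr | nia]. }
destruct (ex_cseries_geometric q (falseThetaTerm q) hq) as [l Hl].
{ intros n. apply Rle_trans with (1 := falseTheta_bound q n hq).
  apply pow_le_pow; [exact hr | lia]. }
unfold Psi. fold a b. rewrite (CSeries_unique a la Hla), (CSeries_unique b lb Hlb).
replace (la - lb) with l; [exact Hl|].
assert (Hab : is_series (fun n => a n - b n) (la - lb))
  by exact (is_series_minus (V := C_NormedModule) a b la lb Hla Hlb).
assert (E : forall N, csum (falseThetaTerm q) (3 * N + 2) = csum (fun n => a n - b n) N).
{ assert (E3 : forall N, falseThetaTerm q (3 * N) + falseThetaTerm q (S (3 * N))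
      + falseThetaTerm q (S (S (3 * N))) = a N - b N).
  { intros N. rewrite Ha, Hb. unfold falseThetaTerm.
    destruct (lucas_mod_3 N) as [H0 [H1 H2]].
    rewrite lucas_period, H0, H1, H2, (Nat.add_1_r (3 * N)). ring. }
  induction N as [|N IH].
  - rewrite csum_0, <- E3. simpl Nat.add. rewrite !csum_S, csum_0. reflexivity.
  - rewrite csum_S, <- E3, <- IH.
    replace (3 * S N + 2)%nat with (S (S (S (3 * N + 2)))) by lia.
    replace (3 * S N)%nat with (S (3 * N + 2)) by lia.
    rewrite !csum_S. ring. }
apply (filterlim_locally_unique (K := C_AbsRing) (V := C_NormedModule) (F := eventually)
         (fun N => csum (falseThetaTerm q) (3 * N + 2))).
- apply (filterlim_comp _ _ _ (fun N => (3 * N + 2)%nat) (sum_n (falseThetaTerm q))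
           eventually eventually); [|exact Hl].
  intros P [N0 HN0]. exists N0. intros n Hn. apply HN0. lia.
- apply filterlim_ext with (sum_n (fun n => a n - b n)); [|exact Hab].
  intros N. symmetry. apply E.
Qed.

Theorem mainTheorem11 (q : C) (hq : (Cmod q < 1)%R) :
  is_series
    (fun n : nat =>
       (-1) ^ n * q ^ (n * (n + 3) / 2) * qPoch (q ^ 3) (q ^ 3) n
         * (1 - q ^ (n + 1)) / qPoch q q (2 * n + 2))
    (Psi (q ^ 15) (q ^ 3)).
Proof.
apply is_series_ext with (fun n => csum (fun j => falseThetaTerm q j * kernel q j (n - j)) n).
- intros n. symmetry. now apply term_expansion.
- apply kernel_transform; [exact hq | | now apply falseTheta_Psi].
  intros j. now apply falseTheta_bound.
Qed.
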